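(* For every integer $N$, the holomorphic Euler characteristic of the canonical line bundle $L_N$ on the quantum projective line $\mathbb{C}P^1_q$ is $$\chi(\mathbb{C}P^1_q,L_N)=-N+1 .$$
   Context: Let $0<q<1$ and $[z]=\frac{q^z-q^{-z}}{q-q^{-1}}$. The finite-dimensional irreducible representations of $U_q(\mathfrak{su}(2))$ are $V_l$, $l\in\frac12\mathbb N$ ($\mathbb N\ni0$), with basis $|l,m\rangle$, $m\in\{-l,-l+1,\dots,l\}$, and $K|l,m\rangle=q^m|l,m\rangle$, $E|l,m\rangle=\sqrt{[l-m+1][l+m]}\,|l,m-1\rangle$, $F|l,m\rangle=\sqrt{[l+m+1][l-m]}\,|l,m+1\rangle$. By Peter–Weyl, $\mathcal A(SU_q(2))\simeq\bigoplus_lV_l\otimes V_l^*$, with basis $|l,n,m\rangle=|l,n\rangle\otimes|l,m\rangle$, and $K,E,F$ act on the first tensor factor. For $N\in\mathbb Z$, $L_N=\{a\in\mathcal A(SU_q(2)): K a=q^{N/2}a\}$ is the linear span of the $|l,\tfrac N2,m\rangle$ with $l\ge|N/2|$, $l-\tfrac N2\in\mathbb Z$, $m\in\{-l,\dots,l\}$. The anti-holomorphic part of the connection on $L_N$ is $\nabla^{\overline\partial}:L_N\to\Omega^{(0,1)}\otimes L_N\simeq L_{N-2}$, $$\nabla^{\overline\partial}|l,\tfrac N2,m\rangle=E|l,\tfrac N2,m\rangle=\sqrt{[l-\tfrac N2+1][l+\tfrac N2]}\;|l,\tfrac N2-1,m\rangle,$$ so the Dolbeault complex is $0\to L_N\xrightarrow{\nabla^{\overline\partial}}L_{N-2}\to0$.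 Its holomorphic Euler characteristic is $\chi(\mathbb{C}P^1_q,L_N):=\dim\ker\nabla^{\overline\partial}-\dim\operatorname{coker}\nabla^{\overline\partial}$. *)

(* Defs.v *)
From HB Require Import structures.
From mathcomp Require Import all_boot all_order all_algebra.
From mathcomp Require Import boolp classical_sets reals exp.
From mathcomp Require Import complex.
From mathcomp Require Import freeg.

Set Implicit Arguments.
Unset Strict Implicit.
Unset Printing Implicit Defensive.

Import Order.TTheory GRing.Theory Num.Theory.

Local Open Scope ring_scope.

Section LinearAlgebra.
Variable K : fieldType.

Definition has_dim (V : lmodType K) (n : nat) : Prop :=
  exists f : {linear V -> 'rV[K]_n}, bijective f.

Definition finite_dim (V : lmodType K) : Prop := exists n, has_dim V n.

(* Meaningful for finite-dimensional spaces only; 0 otherwise. *)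
Definition dim (V : lmodType K) : nat := xget 0%N [set n | has_dim V n]%classic.

Definition subspace (V : lmodType K) (S : submodClosed V) : Type :=
  {v : V | v \in S}.

HB.instance Definition _ (V : lmodType K) (S : submodClosed V) :=
  SubChoice.on (subspace S).
HB.instance Definition _ (V : lmodType K) (S : submodClosed V) :=
  [SubChoice_isSubLmodule of subspace S by <:].

Section KernelCokernel.
Variables (U V : lmodType K) (f : {linear U -> V}).

Definition in_ker : {pred U} := [pred u | f u == 0].

Fact in_ker_submod_closed : submod_closed in_ker.
Proof.
split=> [|a u v]; rewrite !inE ?linear0// => /eqP fu /eqP fv.
by rewrite linearP fu fv scaler0 addr0.
Qed.

HB.instance Definition _ := GRing.isSubmodClosed.Build K U in_ker
  in_ker_submod_closed.

Definition ker : lmodType K := subspace in_ker.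

Definition in_im : {pred V} := [pred v | `[< exists u, f u = v >]].

Fact in_im_submod_closed : submod_closed in_im.
Proof.
split=> [|a v w].
  by apply/asboolP; exists 0; rewrite linear0.
move=> /asboolP[u <-] /asboolP[u' <-]; apply/asboolP.
by exists (a *: u + u'); rewrite linearP.
Qed.

HB.instance Definition _ := GRing.isSubmodClosed.Build K V in_im
  in_im_submod_closed.

Definition coker : Type := Quotient.quot in_im.

HB.instance Definition _ := GRing.Zmodule.on coker.

Definition coker_proj (v : V) : coker := \pi_(Quotient.quot in_im)%qT v.

Lemma coker_projP (v w : V) :
  coker_proj v = coker_proj w <-> exists u, f u = v - w.
Proof.
have E := Quotient.idealrBE in_im v w; split=> [vw|/asboolP].
  by apply/asboolP; rewrite -[`[< _ >]]/(_ \in in_im) E; apply/eqP.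
by move=> vw; apply/eqP; rewrite -E.
Qed.

Lemma coker_projK (x : coker) : coker_proj (repr x : V) = x.
Proof. exact: reprK. Qed.

Lemma coker_projD (v w : V) : coker_proj (v + w) = coker_proj v + coker_proj w.
Proof. exact: (raddfD \pi_(Quotient.quot in_im)%qT). Qed.

Definition coker_scale (a : K) (x : coker) : coker :=
  coker_proj (a *: (repr x : V)).

Lemma coker_projZ (a : K) (v : V) :
  coker_scale a (coker_proj v) = coker_proj (a *: v).
Proof.
have /coker_projP[u fu] := coker_projK (coker_proj v).
by apply/coker_projP; exists (a *: u); rewrite linearZ /= fu scalerBr.
Qed.

Fact coker_scaleA a b x : coker_scale a (coker_scale b x) = coker_scale (a * b) x.
Proof. by rewrite -[x]coker_projK !coker_projZ scalerA. Qed.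

Fact coker_scale1 : left_id 1 coker_scale.
Proof. by move=> x; rewrite -[x]coker_projK coker_projZ scale1r. Qed.

Fact coker_scaleDr : right_distributive coker_scale +%R.
Proof.
move=> a x y; rewrite -[x]coker_projK -[y]coker_projK.
by rewrite -coker_projD !coker_projZ scalerDr coker_projD.
Qed.

Fact coker_scaleDl x : {morph coker_scale^~ x : a b / a + b}.
Proof.
move=> a b; rewrite -[x]coker_projK.
by rewrite !coker_projZ scalerDl coker_projD.
Qed.

HB.instance Definition _ := GRing.Zmodule_isLmodule.Build K coker
  coker_scaleA coker_scale1 coker_scaleDr coker_scaleDl.

End KernelCokernel.

End LinearAlgebra.

Section FreeModule.
Variables (K : fieldType) (I : choiceType) (M : lmodType K).

(* The linear extension of a map defined on the basis. *)
Definition lin_ext (f : I -> M) : {freeg I / K} -> M := fglift f.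

Fact lin_ext_is_linear f : linear (lin_ext f).
Proof.
have addf : additive (lin_ext f) by exact: lift_is_additive.
pose F := GRing.isZmodMorphism.Build _ _ _ addf.
pose g : {additive {freeg I / K} -> M} := HB.pack (lin_ext f) F.
have gZ a D : g (a *: D) = a *: g D.
  rewrite -{2}[D]freeg_sumE [a *: D]/(fgscale a D) !raddf_sum.
  by apply: eq_bigr => i _; rewrite /= /lin_ext !liftU scalerA.
by move=> a D E; rewrite -gZ -[lin_ext f _]/(g _) raddfD.
Qed.

HB.instance Definition _ f := GRing.isLinear.Build K {freeg I / K} M *:%R
  (lin_ext f) (lin_ext_is_linear f).

Lemma lin_extU f i : lin_ext f << i >> = f i.
Proof. by rewrite /lin_ext liftU scale1r. Qed.

Lemma eq_linear_basis (g h : {linear {freeg I / K} -> M}) :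
  (forall i, g << i >> = h << i >>) -> g =1 h.
Proof.
move=> gh D; rewrite -[D]freeg_sumE !linear_sum; apply: eq_bigr => i _ /=.
have -> : << coeff i D *g i >> = coeff i D *: << i >> :> {freeg I / K}.
  by apply/eqP/freeg_eqP => k; rewrite coeffZ !coeffU mul1r.
by rewrite !linearZ /= gh.
Qed.

End FreeModule.

Section QuantumProjectiveLine.
Variable R : realType.
Implicit Types (q z : R) (N : int).

Definition qnum q z : R := (q `^ z - q `^ (- z)) / (q - q^-1).

(* The triple (d; (i, j)) with i, j <= d stands for the basis vector           *)
(* |l, n, m> = |l, n> (x) |l, m> where l = d / 2, n = i - l and m = j - l.      *)
Definition PW_index : choiceType := {d : nat & ('I_d.+1 * 'I_d.+1)%type}.

Definition PW_vec (d : nat) (i j : 'I_d.+1) : PW_index :=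
  Tagged (fun d => ('I_d.+1 * 'I_d.+1)%type) (i, j).

Definition spin (d : nat) : R := d%:R / 2.

Definition weight (d : nat) (i : 'I_d.+1) : R := i%:R - spin d.

Definition A_SUq2 : lmodType R[i] := {freeg PW_index / R[i]}.

Definition K_basis q (x : PW_index) : A_SUq2 :=
  let: existT d (i, j) := x in ((q `^ weight i)%:C)%C *: << PW_vec i j >>.

Definition E_coef q (d : nat) (i : 'I_d.+1) : R :=
  Num.sqrt (qnum q (spin d - weight i + 1) * qnum q (spin d + weight i)).

Lemma E_coef_lowest q d (i : 'I_d.+1) : i = 0%N :> nat -> E_coef q i = 0.
Proof.
move=> i0; rewrite /E_coef /weight i0 sub0r subrr /qnum oppr0 powRr0 subrr.
by rewrite mul0r mulr0 sqrtr0.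
Qed.

(* For i = 0, i.e. n = -l, the junk value |l, n, m> of the vector is multiplied  *)
(* by E_coef q i = 0, so that E |l, -l, m> = 0.                                  *)
Definition E_basis q (x : PW_index) : A_SUq2 :=
  let: existT d (i, j) := x in
  ((E_coef q i)%:C)%C *: << PW_vec (inord i.-1) j >>.

Definition K_op q : {linear A_SUq2 -> A_SUq2} := lin_ext (K_basis q).

Definition E_op q : {linear A_SUq2 -> A_SUq2} := lin_ext (E_basis q).

Lemma K_E q (a : A_SUq2) : 0 < q ->
  K_op q (E_op q a) = ((q^-1)%:C)%C *: E_op q (K_op q a).
Proof.
move=> q0.
pose g : {linear A_SUq2 -> A_SUq2} := K_op q \o E_op q.
pose h : {linear A_SUq2 -> A_SUq2} := ((q^-1)%:C)%C \*: (E_op q \o K_op q).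
suff gh : g =1 h by exact: gh.
apply: eq_linear_basis => -[d [i j]].
rewrite /g /h /= /K_op /E_op !lin_extU /=.
rewrite [LHS]linearZ /= lin_extU /= [X in _ = _ *: X]linearZ /= lin_extU /=.
rewrite !scalerA -!rmorphM; congr ((_)%:C%C *: _).
have [i0|i0] := posnP i.
  by rewrite E_coef_lowest// !(mulr0, mul0r).
rewrite -[q^-1]powR_inv1 ?ltW// -powRD ?(gt_eqF q0) ?implybT//.
rewrite mulrC; congr (_ `^ _ * _).
rewrite /weight inordK; last by rewrite (leq_ltn_trans (leq_pred _)).
by rewrite -subn1 natrB// addrA [_ + i%:R]addrC.
Qed.

Definition in_LN q N : {pred A_SUq2} :=
  [pred a | K_op q a == ((q `^ (N%:~R / 2))%:C)%C *: a].

Fact in_LN_submod_closed q N : submod_closed (in_LN q N).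
Proof.
split=> [|c a b /eqP Ka /eqP Kb]; apply/eqP.
  by rewrite [LHS]linear0 [RHS]scaler0.
by rewrite [LHS]linearP Ka Kb scalerDr !scalerA mulrC.
Qed.

HB.instance Definition _ q N := GRing.isSubmodClosed.Build R[i] A_SUq2
  (in_LN q N) (in_LN_submod_closed q N).

Definition LN q N : lmodType R[i] := subspace (in_LN q N).

Section Dolbeault.
Variables (q : R) (q01 : 0 < q < 1) (N : int).

Fact E_LN (a : LN q N) : E_op q (val a) \in in_LN q (N - 2).
Proof.
have /andP[q0 _] := q01; have /eqP Ka := valP a.
apply/eqP; rewrite K_E// Ka [X in _ *: X = _]linearZ scalerA -rmorphM.
congr ((_)%:C%C *: _); rewrite -[q^-1]powR_inv1 ?ltW// -powRD ?(gt_eqF q0) ?implybT//.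
by congr (_ `^ _); rewrite rmorphB /= mulrBl divff ?pnatr_eq0// addrC.
Qed.

(* The anti-holomorphic connection L_N -> Omega^(0,1) (x) L_N = L_(N-2). *)
Definition nabla_dbar (a : LN q N) : LN q (N - 2) := Sub (E_op q (val a)) (E_LN a).

Fact nabla_dbar_is_linear : linear nabla_dbar.
Proof. by move=> c a b; apply: val_inj; rewrite /= !linearP. Qed.

HB.instance Definition _ := GRing.isLinear.Build R[i] (LN q N) (LN q (N - 2))
  *:%R nabla_dbar nabla_dbar_is_linear.

Definition holomorphic_euler_char : int :=
  (dim (ker nabla_dbar))%:Z - (dim (coker nabla_dbar))%:Z.

End Dolbeault.

End QuantumProjectiveLine.

(* Main.v *)
Require Import Defs.
From HB Require Import structures.
From mathcomp Require Import all_boot all_order all_algebra.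
From mathcomp Require Import reals complex.
From mathcomp Require Import boolp classical_sets exp freeg zify.

(** On each column |l, ., m> of the Peter-Weyl basis the operator E lowers n by
    one, and its coefficient sqrt([l - n + 1] [l + n]) vanishes only at the
    bottom n = -l, because [z] > 0 for z > 0 ([E_coef_neq0]).  As L_N is spanned
    by the basis vectors with n = N/2 ([in_LNP]), the map L_N -> L_(N-2) can
    only fail to be bijective at the two ends of the columns:
    - its kernel is spanned by the bottom vectors |l, -l, m> of L_N.  They exist
      only if N <= 0, when l = -N/2, and there are 2l + 1 = -N + 1 of them
      ([has_dim_ker], [has_dim_ker0]);
    - its cokernel is spanned by the classes of the top vectors |l, l, m> of
      L_(N-2), which E never reaches.  They exist only if N >= 2, when
      l = N/2 - 1, and there are 2l + 1 = N - 1 of them ([has_dim_coker],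
      [has_dim_coker0]).
    That every other vector is in the image is seen from an explicit right
    inverse of E on the vectors without top component ([E_raise]).  In all three
    cases N <= 0, N = 1 and N >= 2, the difference of the dimensions is -N + 1.
    In the encoding d = 2l and i = l + n, so the bottom is i = 0, the top is
    i = d, and the condition n = N/2 reads 2i = N + d. *)

Set Implicit Arguments.
Unset Strict Implicit.
Unset Printing Implicit Defensive.

Import Order.TTheory GRing.Theory Num.Theory.
Local Open Scope ring_scope.

(** * Dimension from a basis *)

Section Dimension.
Variable K : fieldType.

(** Composing the two isomorphisms gives an injective p x r matrix, so p <= r. *)
Lemma has_dim_unique (V : lmodType K) m n : has_dim V m -> has_dim V n -> m = n.
Proof.
suff le p r : has_dim V p -> has_dim V r -> (p <= r)%N.
  by move=> hm hn; apply/eqP; rewrite eqn_leq !le.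
case=> f fbij [g gbij].
have f_inj := bij_inj fbij; have [f' fK f'K] := fbij.
have f'L : linear f'.
  by move=> a u v; apply: f_inj; rewrite linearP !f'K.
pose F := GRing.isLinear.Build K 'rV[K]_p V *:%R f' f'L.
pose f'l : {linear 'rV[K]_p -> V} := HB.pack f' F.
pose h : {linear 'rV[K]_p -> 'rV[K]_r} := g \o f'l.
have h_inj : injective h.
  by apply: inj_comp (bij_inj gbij) (can_inj f'K).
have : row_free (lin1_mx h).
  apply: inj_row_free => v; rewrite mul_rV_lin1 => hv.
  by apply: h_inj; rewrite hv linear0.
by move=> /eqP <-; exact: rank_leq_col.
Qed.

Lemma dim_eq (V : lmodType K) n : has_dim V n -> Defs.dim V = n.
Proof.
by move=> Vn; apply: xget_unique => // m Vm; exact: has_dim_unique Vm Vn.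
Qed.

(** The dimension is defined by an isomorphism onto row vectors, whereas a basis
    gives one in the other direction; its inverse is obtained by choice. *)
Lemma has_dim_basis (V : lmodType K) n (e : 'I_n -> V) :
  (forall r : 'rV[K]_n, \sum_j r 0 j *: e j = 0 -> r = 0) ->
  (forall v, exists r : 'rV[K]_n, v = \sum_j r 0 j *: e j) ->
  has_dim V n.
Proof.
move=> e_free e_span.
pose s (r : 'rV[K]_n) := \sum_j r 0 j *: e j.
have sL : linear s.
  move=> a u v; rewrite /s scaler_sumr -big_split; apply: eq_bigr => j _ /=.
  by rewrite !mxE scalerDl scalerA.
pose F := GRing.isLinear.Build K 'rV[K]_n V *:%R s sL.
pose sl : {linear 'rV[K]_n -> V} := HB.pack s F.
have s_inj : injective s.
  move=> u v suv; apply/eqP; rewrite -subr_eq0; apply/eqP/e_free.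
  by rewrite -[LHS]/(sl (u - v)) linearB /= suv subrr.
pose c v := projT1 (cid (e_span v)).
have cK : cancel c s by move=> v; rewrite /c; case: cid => r /= ->.
have cL : linear c.
  by move=> a u v; apply: s_inj; rewrite cK -[s (_ + _)]/(sl _) linearP /= !cK.
pose G := GRing.isLinear.Build K V 'rV[K]_n *:%R c cL.
pose cl : {linear V -> 'rV[K]_n} := HB.pack c G.
by exists cl; exists s => // r; apply: s_inj; rewrite /= cK.
Qed.

Lemma has_dim0 (V : lmodType K) : (forall v : V, v = 0) -> has_dim V 0.
Proof.
move=> V0; apply: (has_dim_basis (e := fun=> 0)) => [r _|v].
  exact: thinmx0.
by exists 0; rewrite big_ord0.
Qed.

End Dimension.

(** * Coordinates in a free module *)

Section LinearExtension.
Variables (K : fieldType) (I : choiceType).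

Lemma coeff_sum_basis (T : finType) (r : T -> K) (e : T -> {freeg I / K}) x :
  coeff x (\sum_j r j *: e j) = \sum_j r j * coeff x (e j).
Proof. by rewrite raddf_sum; apply: eq_bigr => j _; rewrite /= coeffZ. Qed.

(** For a map sending basis vectors to multiples of basis vectors, a coordinate
    of the image depends on a single coordinate of the argument; c = 0 covers
    the coordinates that the map never reaches. *)
Lemma coeff_lin_ext (f : I -> {freeg I / K}) (c : K) x y :
    (forall i, coeff y (f i) = c * (i == x)%:R) ->
  forall D, coeff y (lin_ext f D) = c * coeff x D.
Proof.
move=> fE D; rewrite -[D in LHS]freeg_sumE linear_sum raddf_sum /=.
rewrite -[D in RHS]freeg_sumE raddf_sum mulr_sumr; apply: eq_bigr => i _ /=.
by rewrite /lin_ext liftU coeffZ fE coeffU mulrCA.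
Qed.

End LinearExtension.

(** * The operators K and E in Peter-Weyl coordinates *)

Section QuantumProjectiveLine.
Variables (R : realType) (q : R) (q01 : 0 < q < 1).
Implicit Types (a b : A_SUq2 R) (N : int).

(** Destructing an index leaves canonical-structure types in the context, under
    which comparisons of natural numbers are no longer recognised; this
    principle keeps plain types. *)
Lemma PW_index_ind (P : PW_index -> Prop) :
  (forall d (i j : 'I_d.+1), P (PW_vec i j)) -> forall x, P x.
Proof. by move=> PP [d [i j]]; exact: PP. Qed.

Lemma PW_vec_eq d d' (i j : 'I_d.+1) (i' j' : 'I_d'.+1) :
  (PW_vec i j == PW_vec i' j') =
    [&& d == d', i == i' :> nat & j == j' :> nat].
Proof.
case: (eqVneq d d') i' j' => [<-|dd'] i' j' /=.
  by rewrite /PW_vec eq_Tagged /= xpair_eqE.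
by apply/negP => /eqP[] /eqP; rewrite (negPf dd').
Qed.

(** At the top i = d, the successor of i wraps around to the bottom, where the
    coefficient of E is 0.  This makes the coordinate formulas for E and its
    partial inverse valid without a side condition. *)
Lemma inord_overflow d : inord d.+1 = 0 :> 'I_d.+1.
Proof. by apply/val_inj; rewrite /= /inord /insubd insubF //= ltnn. Qed.

Lemma A_SUq2_eqP a b :
  (forall d (i j : 'I_d.+1), coeff (PW_vec i j) a = coeff (PW_vec i j) b) ->
  a = b.
Proof. by move=> ab; apply/eqP/freeg_eqP; exact: PW_index_ind. Qed.

Lemma coeff_PW_row d (i j : 'I_d.+1) (r : 'I_d.+1 -> R[i]) :
  coeff (PW_vec i j) (\sum_k r k *: << PW_vec i k >>) = r j.
Proof.
rewrite coeff_sum_basis (bigD1 j) //= coeffU eqxx !mulr1 big1 ?addr0 // => k kj.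
by rewrite coeffU PW_vec_eq !eqxx /= (inj_eq val_inj) (negPf kj) !mulr0.
Qed.

Lemma PW_row_expand d (i : 'I_d.+1) a :
  (forall d' (i' j' : 'I_d'.+1), coeff (PW_vec i' j') a != 0 ->
     d' = d /\ i' = i :> nat) ->
  a = \sum_j coeff (PW_vec i j) a *: << PW_vec i j >>.
Proof.
move=> supp; apply: A_SUq2_eqP => d' i' j'.
have [d'd|d'd] := eqVneq d' d; last first.
  have -> : coeff (PW_vec i' j') a = 0.
    by apply: contraNeq d'd => /supp[/eqP].
  rewrite coeff_sum_basis big1 // => k _.
  by rewrite coeffU PW_vec_eq eq_sym (negPf d'd) !mulr0.
move: i' j'; rewrite d'd => i' j'.
have [->|i'i] := eqVneq i' i.
  by rewrite (coeff_PW_row i j' (fun j => coeff (PW_vec i j) a)).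
have -> : coeff (PW_vec i' j') a = 0.
  by apply: contraNeq i'i => /supp[_ /val_inj ->].
rewrite coeff_sum_basis big1 // => k _.
by rewrite coeffU PW_vec_eq eqxx /= eq_sym (inj_eq val_inj) (negPf i'i) !mulr0.
Qed.

(** Since q < 1, both q^z - q^(-z) and q - q^(-1) are negative. *)
Lemma qnum_gt0 (z : R) : 0 < z -> 0 < qnum q z.
Proof.
move=> z0; have /andP[q0 q1] := q01.
have lt1 (x : R) : 0 < x < 1 -> x < x^-1.
  by case/andP=> x0 x1; rewrite (lt_trans x1)// invf_gt1.
rewrite /qnum -mulrNN -(invrN (q - q^-1)) !opprB.
rewrite mulr_gt0 ?invr_gt0 ?subr_gt0 ?powRN ?lt1 ?q01//.
have := gt0_ltr_powR z0 _ _ q1; rewrite powR1 powR_gt0 //=; apply.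
  by rewrite nnegrE ltW.
by rewrite nnegrE ler01.
Qed.

Lemma E_coef_neq0 d (i : 'I_d.+1) : (0 < i)%N -> E_coef q i != 0.
Proof.
(* l - n + 1 = d - i + 1 and l + n = i are both positive. *)
have splitd : spin R d + spin R d = d%:R by rewrite /spin -splitr.
move=> i0; rewrite gt_eqF// sqrtr_gt0 mulr_gt0 ?qnum_gt0 //.
- rewrite /weight opprB addrA splitd ltr_wpDl//.
  by rewrite subr_ge0 ler_nat -ltnS.
- by rewrite /weight addrC subrK ltr0n.
Qed.

Lemma coeff_K_op a d (i j : 'I_d.+1) :
  coeff (PW_vec i j) (K_op q a) =
    ((q `^ weight R i)%:C)%C * coeff (PW_vec i j) a.
Proof.
apply: coeff_lin_ext; apply: PW_index_ind => d' i' j'.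
rewrite [K_basis _ _]/= coeffZ coeffU mul1r.
have [e|_] := eqVneq (PW_vec i' j') (PW_vec i j); last by rewrite !mulr0.
move/eqP: e; rewrite PW_vec_eq /weight => /and3P[/eqP dd' /eqP-> _].
by rewrite dd'.
Qed.

(** K is diagonal with eigenvalue q^n on |l, n, m>, and q is not 1, so distinct
    n have distinct eigenvalues. *)
Lemma in_LNP N a :
  reflect (forall d (i j : 'I_d.+1),
             coeff (PW_vec i j) a != 0 -> i.*2%:Z = N + d%:Z)
          (a \in in_LN q N).
Proof.
have /andP[q0 q1] := q01.
have weightE d (i : 'I_d.+1) :
    (weight R i == N%:~R / 2) = (i.*2%:Z == N + d%:Z).
  have two0 : (2 : R) != 0 by rewrite pnatr_eq0.
  rewrite -(inj_eq (mulIf two0)) /weight mulrBl !divfK//.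
  by rewrite subr_eq -natrM muln2 -[RHS](eqr_int R) intrD.
apply: (iffP eqP) => [Ka d i j aij|supp].
  (* Cancelling the coordinate leaves q^n = q^(N/2); then take logarithms. *)
  have := congr1 (coeff (PW_vec i j)) Ka.
  rewrite coeff_K_op coeffZ => /(mulIf aij) [] /(congr1 (@ln R)).
  rewrite !ln_powR.
  have lnq0 : ln q != 0 by rewrite lt_eqF // ln_lt0 // q0.
  by move=> /(mulIf lnq0) /eqP; rewrite weightE => /eqP.
apply: A_SUq2_eqP => d i j; rewrite coeff_K_op coeffZ.
have [->|/supp/eqP] := eqVneq (coeff (PW_vec i j) a) 0; first by rewrite !mulr0.
by rewrite -weightE => /eqP ->.
Qed.

Lemma PW_vec_in_LN N d (i j : 'I_d.+1) : i.*2%:Z = N + d%:Z ->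
  (<< PW_vec i j >> : A_SUq2 R) \in in_LN q N.
Proof.
move=> iN; apply/in_LNP => d' i' j'; rewrite coeffU mul1r PW_vec_eq.
by case: and3P => [[/eqP dd' /eqP <- _] _|]; rewrite -?dd' ?eqxx.
Qed.

Lemma coeff_E_op a d (i j : 'I_d.+1) :
  coeff (PW_vec i j) (E_op q a) =
    ((E_coef q (inord i.+1 : 'I_d.+1))%:C)%C *
      coeff (PW_vec (inord i.+1) j) a.
Proof.
apply: coeff_lin_ext; apply: PW_index_ind => d' i' j'.
rewrite [E_basis _ _]/= coeffZ coeffU mul1r.
rewrite !PW_vec_eq; case: (eqVneq d' d) i' j' => [->|//] i' j' /=.
2: by rewrite !mulr0.
have [_|_] := eqVneq (j' : nat) j; last by rewrite !andbF !mulr0.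
rewrite !andbT inordK ?(leq_ltn_trans (leq_pred _))//.
have [i'0|i'0] := posnP i'.
  rewrite E_coef_lowest // mul0r.
  have [e|_] := eqVneq; last by rewrite mulr0.
  by rewrite E_coef_lowest -?e // mul0r.
have [ltid|] := ltnP i d.
  rewrite inordK ?ltnS// -(inj_eq succn_inj) prednK//.
  have [e|_] := eqVneq; last by rewrite !mulr0.
  by congr ((E_coef q _)%:C%C * _); apply: val_inj; rewrite /= inordK.
move=> ledi; have -> : inord i.+1 = 0 :> 'I_d.+1.
  by rewrite (_ : i = d :> nat) ?inord_overflow//; have := ltn_ord i; lia.
rewrite [E_coef q 0]E_coef_lowest // mul0r.
have := ltn_ord i'; case: eqVneq => [|_]; [lia|by rewrite mulr0].
Qed.

(** * Raising as a partial inverse of E *)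

(** Raises n by one, dividing by the coefficient that E has on the way back.  A
    top vector is sent to 0, as its successor wraps around to the bottom, where
    the coefficient 0 has inverse 0. *)
Definition raise_basis (x : PW_index) : A_SUq2 R :=
  let: existT d (i, j) := x in
  (((E_coef q (inord i.+1 : 'I_d.+1))^-1)%:C)%C *: << PW_vec (inord i.+1) j >>.

Definition raise_op : {linear A_SUq2 R -> A_SUq2 R} := lin_ext raise_basis.

Lemma coeff_raise_op a d (i j : 'I_d.+1) :
  coeff (PW_vec i j) (raise_op a) =
    (((E_coef q i)^-1)%:C)%C * coeff (PW_vec (inord i.-1) j) a.
Proof.
apply: coeff_lin_ext; apply: PW_index_ind => d' i' j'.
rewrite [raise_basis _]/= coeffZ coeffU mul1r.
rewrite !PW_vec_eq; case: (eqVneq d' d) i' j' => [->|//] i' j' /=.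
2: by rewrite !mulr0.
have [_|_] := eqVneq (j' : nat) j; last by rewrite !andbF !mulr0.
rewrite !andbT [inord i.-1 : nat]inordK ?(leq_ltn_trans (leq_pred _))//.
have [i0|i0] := posnP i.
  rewrite [E_coef q i]E_coef_lowest // invr0 mul0r.
  have [e|_] := eqVneq; last by rewrite mulr0.
  by rewrite E_coef_lowest ?e // invr0 mul0r.
have [ltid|] := ltnP i' d.
  rewrite inordK ?ltnS// -[in RHS](inj_eq succn_inj) prednK//.
  have [e|_] := eqVneq; last by rewrite !mulr0.
  by congr (((E_coef q _)^-1)%:C%C * _); apply: val_inj; rewrite /= inordK.
move=> ledi; have -> : inord i'.+1 = 0 :> 'I_d.+1.
  by rewrite (_ : i' = d :> nat) ?inord_overflow//; have := ltn_ord i'; lia.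
rewrite [E_coef q 0]E_coef_lowest // invr0 mul0r.
have := ltn_ord i; case: eqVneq => [|_]; [lia|by rewrite mulr0].
Qed.

(** A top vector is not in the image of E, hence the hypothesis. *)
Lemma E_raise b : (forall d (j : 'I_d.+1), coeff (PW_vec ord_max j) b = 0) ->
  E_op q (raise_op b) = b.
Proof.
move=> top0; apply: A_SUq2_eqP => d i j; rewrite coeff_E_op coeff_raise_op.
have [ltid|ledi] := ltnP i d.
  have c0 : E_coef q (inord i.+1 : 'I_d.+1) != 0.
    by rewrite E_coef_neq0 // inordK.
  have -> : inord (inord i.+1 : 'I_d.+1).-1 = i.
    by rewrite (@inordK d i.+1 ltid) inord_val.
  by rewrite mulrA -rmorphM divff // rmorph1 mul1r.
have -> : i = ord_max by apply: val_inj => /=; have := ltn_ord i; lia.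
by rewrite top0 inord_overflow E_coef_lowest // mul0r.
Qed.

Lemma raise_in_LN N b : b \in in_LN q (N - 2) -> raise_op b \in in_LN q N.
Proof.
move=> /in_LNP bN; apply/in_LNP => d i j.
rewrite coeff_raise_op mulf_eq0 negb_or.
case/andP; have [i0|i0 _] := posnP i.
  by rewrite E_coef_lowest // invr0 eqxx.
move=> /bN; rewrite inordK ?(leq_ltn_trans (leq_pred _))//; lia.
Qed.

(** * The kernel of the connection *)

Lemma E_op_lowest d (j : 'I_d.+1) : E_op q << PW_vec 0 j >> = 0 :> A_SUq2 R.
Proof. by rewrite [LHS]lin_extU /= E_coef_lowest // scale0r. Qed.

(** The coordinate of E a one step below (i, j) is a nonzero multiple of that of
    a at (i, j), unless i = 0. *)
Lemma ker_E_support a d (i j : 'I_d.+1) :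
  E_op q a = 0 -> coeff (PW_vec i j) a != 0 -> i = 0.
Proof.
move=> Ea0; apply: contraNeq => i0.
have ipos : (0 < i)%N by rewrite lt0n.
have := congr1 (coeff (PW_vec (inord i.-1) j)) Ea0.
rewrite coeff_E_op coeff0 inordK ?(leq_ltn_trans (leq_pred _))//.
rewrite prednK // inord_val => /eqP; rewrite mulf_eq0.
by case/orP => // /eqP[] /eqP; rewrite (negPf (E_coef_neq0 ipos)).
Qed.

(** The bottom vectors with d = -N, one for each j <= d, form a basis. *)
Lemma has_dim_ker N d : N = - d%:Z ->
  has_dim (ker (nabla_dbar q01 (N := N))) d.+1.
Proof.
move=> Nd.
have lowN (j : 'I_d.+1) : (<< PW_vec 0 j >> : A_SUq2 R) \in in_LN q N.
  by apply: PW_vec_in_LN; rewrite Nd addNr.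
pose u (j : 'I_d.+1) : LN q N := Sub << PW_vec 0 j >> (lowN j).
have lowK (j : 'I_d.+1) : u j \in in_ker (nabla_dbar q01 (N := N)).
  by rewrite inE; apply/eqP/val_inj; exact: E_op_lowest.
pose e (j : 'I_d.+1) : ker (nabla_dbar q01 (N := N)) := Sub (u j) (lowK j).
have valE (r : 'rV_d.+1) : val (val (\sum_j r 0 j *: e j)) =
    \sum_j r 0 j *: << PW_vec 0 j >> :> A_SUq2 R.
  by rewrite !linear_sum.
apply: (has_dim_basis (e := e)) => [r r0|v].
  apply/rowP => j; rewrite mxE.
  rewrite -[LHS](coeff_PW_row 0 j (fun k => r 0 k)) -valE r0.
  by rewrite !linear0 coeff0.
exists (\row_j coeff (PW_vec 0 j) (val (val v) : A_SUq2 R)).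
apply/val_inj/val_inj; rewrite valE.
under eq_bigr do rewrite mxE.
apply: PW_row_expand => d' i j.
have Ev : E_op q (val (val v)) = 0.
  by have /eqP/(congr1 val) := valP v.
have /in_LNP vN := valP (val v).
move=> vij; have i0 := ker_E_support Ev vij.
by have := vN _ _ _ vij; rewrite Nd i0 /=; lia.
Qed.

Lemma has_dim_ker0 N : 0 < N -> has_dim (ker (nabla_dbar q01 (N := N))) 0.
Proof.
move=> N0; apply: has_dim0 => v; apply/val_inj/val_inj.
apply: A_SUq2_eqP => d i j; rewrite coeff0; apply/eqP.
have Ev : E_op q (val (val v)) = 0.
  by have /eqP/(congr1 val) := valP v.
have /in_LNP vN := valP (val v).
apply: contraT => vij; have i0 := ker_E_support Ev vij.
by have := vN _ _ _ vij; rewrite i0 /=; lia.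
Qed.

(** * The cokernel of the connection *)

Lemma im_nabla N (v : LN q (N - 2)) :
  (forall d (j : 'I_d.+1), coeff (PW_vec ord_max j) (val v) = 0) ->
  exists u, nabla_dbar q01 (N := N) u = v.
Proof.
move=> top0; exists (Sub (raise_op (val v)) (raise_in_LN (valP v)) : LN q N).
by apply: val_inj; exact: E_raise.
Qed.

Lemma top_weight N (v : LN q (N - 2)) d (j : 'I_d.+1) :
  coeff (PW_vec ord_max j) (val v) != 0 -> N - 2 = d%:Z.
Proof. by have /in_LNP bN := valP v; move=> /bN /=; lia. Qed.

Lemma has_dim_coker0 N : N < 2 -> has_dim (coker (nabla_dbar q01 (N := N))) 0.
Proof.
move=> N2; apply: has_dim0 => v; rewrite -[v]coker_projK.
have -> : 0 = coker_proj (nabla_dbar q01 (N := N)) 0.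
  by rewrite /coker_proj raddf0.
apply/coker_projP; rewrite subr0; apply: im_nabla => d j.
by apply/eqP; apply: contraT => /top_weight; lia.
Qed.

(** The classes of the top vectors with d = N - 2, one for each j <= d, form a
    basis: they are independent because E a has no top coordinates, and
    they span because a vector without top coordinates is in the image. *)
Lemma has_dim_coker N d : N - 2 = d%:Z ->
  has_dim (coker (nabla_dbar q01 (N := N))) d.+1.
Proof.
move=> Nd.
have topN (j : 'I_d.+1) :
    (<< PW_vec ord_max j >> : A_SUq2 R) \in in_LN q (N - 2).
  by apply: PW_vec_in_LN; rewrite Nd /=; lia.
pose u (j : 'I_d.+1) : LN q (N - 2) := Sub << PW_vec ord_max j >> (topN j).
pose e (j : 'I_d.+1) : coker (nabla_dbar q01 (N := N)) := coker_proj _ (u j).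
have eE (r : 'rV_d.+1) :
    \sum_j r 0 j *: e j = coker_proj _ (\sum_j r 0 j *: u j).
  rewrite /coker_proj raddf_sum; apply: eq_bigr => j _.
  exact: coker_projZ.
have valE (r : 'rV_d.+1) : val (\sum_j r 0 j *: u j) =
    \sum_j r 0 j *: << PW_vec ord_max j >> :> A_SUq2 R.
  by rewrite linear_sum.
have coker0 : 0 = coker_proj (nabla_dbar q01 (N := N)) 0.
  by rewrite /coker_proj raddf0.
apply: (has_dim_basis (e := e)) => [r|v].
  rewrite eE coker0 => /coker_projP[a]; rewrite subr0 => Ea.
  apply/rowP => j; rewrite mxE.
  rewrite -[LHS](coeff_PW_row ord_max j (fun k => r 0 k)) -valE -Ea.
  by rewrite coeff_E_op inord_overflow E_coef_lowest // mul0r.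
pose b : LN q (N - 2) := repr v.
exists (\row_j coeff (PW_vec ord_max j) (val b)); rewrite eE -[v]coker_projK.
apply/coker_projP/im_nabla => d' j; apply/eqP; apply: contraT => nz.
have d'd : d' = d by have := top_weight nz; rewrite Nd => -[].
move: j nz; rewrite d'd => j; rewrite raddfB /= valE.
pose r : 'rV[R[i]]_d.+1 := \row_k coeff (PW_vec ord_max k) (val b).
by rewrite (coeff_PW_row ord_max j (fun k => r 0 k)) mxE subrr eqxx.
Qed.

End QuantumProjectiveLine.

(** * The Euler characteristic *)

Theorem mainTheorem4 (R : realType) (q : R) (q01 : 0 < q < 1) (N : int) :
  [/\ finite_dim (ker (nabla_dbar q01 (N := N))),
      finite_dim (coker (nabla_dbar q01 (N := N))) &
      holomorphic_euler_char q01 N = - N + 1].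
Proof.
suff [m [n [kerN cokerN mn]]] : exists m n,
    [/\ has_dim (ker (nabla_dbar q01 (N := N))) m,
        has_dim (coker (nabla_dbar q01 (N := N))) n &
        m%:Z - n%:Z = - N + 1].
  split; [by exists m | by exists n |].
  by rewrite /holomorphic_euler_char (dim_eq kerN) (dim_eq cokerN).
have [N0|N0] := lerP N 0.
  exists (absz N).+1, 0%N; split; [|apply: has_dim_coker0|]; try lia.
  by apply: has_dim_ker; lia.
have [N2|N2] := ltrP N 2.
  exists 0%N, 0%N; split; [exact: has_dim_ker0|exact: has_dim_coker0|lia].
exists 0%N, (absz (N - 2)).+1; split; [exact: has_dim_ker0| |lia].
by apply: has_dim_coker; lia.
Qed.
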